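(* The assignment of the compact separated proximity space $\mathcal{U}X$ to the coarse proximity space $(X,\mathcal{B},{\bf b})$, together with the assignment of the proximity map $\mathcal{U}f:\mathcal{U}X\to\mathcal{U}Y$ to a closeness class of coarse proximity maps $[f]:(X,\mathcal{B}_X,{\bf b}_X)\to(Y,\mathcal{B}_Y,{\bf b}_Y)$, makes up a functor from the category ${\bf CrsProx}$ of coarse proximity spaces with closeness classes of coarse proximity maps to the category ${\bf CSProx}$ of compact separated proximity spaces with proximity maps.
   Context: Coarse proximity spaces. A bornology $\mathcal{B}$ on a set $X$ is a family of subsets containing all singletons and closed under subsets and finite unions; its members are called bounded, other subsets unbounded. A coarse proximity on $(X,\mathcal{B})$ is a relation ${\bf b}$ on the power set of $X$ such that for all $A,B,C\subseteq X$: (1) $A{\bf b}B\Rightarrow B{\bf b}A$; (2) $A{\bf b}B\Rightarrow A,B\notin\mathcal{B}$; (3) $A\cap B\notin\mathcal{B}\Rightarrow A{\bf b}B$; (4) $(A\cup B){\bf b}C\iff A{\bf b}C$ or $B{\bf b}C$; (5) $A\bar{\bf b}B\Rightarrow\exists E\subseteq X$ with $A\bar{\bf b}E$ and $(X\setminus E)\bar{\bf b}B$ (a bar denotes negation). Then $(X,\mathcal{B},{\bf b})$ is a coarse proximity space. Its weak asymptotic resemblance $\phi_{\bf b}$ is: $A\phi_{\bf b} B$ iff $A{\bf b}B'$ for every unbounded $B'\subseteq B$ and $A'{\bf b}B$ for every unbounded $A'\subseteq A$ (an equivalence relation). A coarse proximity map $f:(X,\mathcal{B}_X,{\bf b}_X)\to(Y,\mathcal{B}_Y,{\bf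 b}_Y)$ is a function such that $B\in\mathcal{B}_X\Rightarrow f(B)\in\mathcal{B}_Y$ and $A{\bf b}_XB\Rightarrow f(A){\bf b}_Yf(B)$. Two functions $f,g:X\to Y$ are close if $f(A)\phi_{{\bf b}_Y}g(A)$ for all $A\subseteq X$. In ${\bf CrsProx}$ the morphisms are closeness classes $[f]$ of coarse proximity maps, with $[g]\circ[f]=[g\circ f]$. Proximities and clusters. A proximity on a set $X$ is a relation $\delta$ on the power set with: (1) $A\delta B\Rightarrow B\delta A$; (2) $A\delta B\Rightarrow A,B\ne\emptyset$; (3) $A\cap B\neq\emptyset\Rightarrow A\delta B$; (4) $A\delta(B\cup C)\iff A\delta B$ or $A\delta C$; (5) $A\bar\delta B\Rightarrow\exists E\subseteq X$ with $A\bar\delta E$ and $(X\setminus E)\bar\delta B$. It is separated if $\{x\}\delta\{y\}\iff x=y$. It induces the topology in which $A$ is closed iff ($A\delta\{x\}\Rightarrow x\in A$). A proximity map is a function $f$ with $A\delta_XB\Rightarrow f(A)\delta_Yf(B)$. A cluster in $(X,\delta)$ is a collection $\sigma$ of subsets of $X$ such that: $A,B\in\sigma\Rightarrow A\delta B$; if $A\delta B$ for all $B\in\sigma$ then $A\in\sigma$; if $A\cup B\in\sigma$ then $A\in\sigma$ or $B\in\sigma$. For $\delta$ separated, the Smirnov compactification $\mathfrak{X}$ is the set of all clusters with the proximity $\mathcal{A}\delta^*\mathcal{C}$ iff $A\delta C$ for all $A,C\subseteq X$ such that $A\in\sigma$ for all $\sigma\in\mathcal{A}$ and $C\in\sigma$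 for all $\sigma\in\mathcal{C}$; it is compact Hausdorff. Boundary. The discrete extension of ${\bf b}$ is the separated proximity $A\delta_{dis,{\bf b}}B\iff A\cap B\ne\emptyset$ or $A{\bf b}B$. The boundary $\mathcal{U}X$ is the set of clusters in $(X,\delta_{dis,{\bf b}})$ containing no bounded set, with the subspace proximity inherited from the Smirnov compactification of $(X,\delta_{dis,{\bf b}})$. The map $\mathcal{U}f$. For a coarse proximity map $f:X\to Y$ and $\sigma_1\in\mathcal{U}X$, $\mathcal{U}f(\sigma_1)=\{A\subseteq Y\mid A\,\delta_{dis,{\bf b}_Y}f(C)\text{ for all }C\in\sigma_1\}$. (This is the restriction to $\mathcal{U}X\to\mathcal{U}Y$ of the unique extension of $f$ to a proximity map between the Smirnov compactifications of $(X,\delta_{dis,{\bf b}_X})$ and $(Y,\delta_{dis,{\bf b}_Y})$.) *)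

(* Defs.v *)
From HB Require Import structures.
From mathcomp Require Import all_boot all_order.
From mathcomp Require Import boolp classical_sets functions topology.

Set Implicit Arguments.
Unset Strict Implicit.
Unset Printing Implicit Defensive.

Local Open Scope classical_set_scope.

Record category := Category {
  object :> Type;
  hom : object -> object -> Type;
  idm : forall X, hom X X;
  comp : forall X Y Z, hom Y Z -> hom X Y -> hom X Z;
  comp_idl : forall X Y (f : hom X Y), comp (idm Y) f = f;
  comp_idr : forall X Y (f : hom X Y), comp f (idm X) = f;
  comp_assoc : forall X Y Z W (h : hom Z W) (g : hom Y Z) (f : hom X Y),
    comp h (comp g f) = comp (comp h g) f
}.

Arguments hom {c}.
Arguments idm {c}.
Arguments comp {c X Y Z}.

Record is_functor (C D : category) (F0 : C -> D)
    (F1 : forall X Y : C, hom X Y -> hom (F0 X) (F0 Y)) : Prop := IsFunctor {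
  functor_id : forall X : C, F1 X X (idm X) = idm (F0 X);
  functor_comp : forall (X Y Z : C) (g : hom Y Z) (f : hom X Y),
    F1 X Z (comp g f) = comp (F1 Y Z g) (F1 X Y f)
}.

Record is_proximity (T : Type) (near : set T -> set T -> Prop) : Prop :=
  IsProximity {
  prox_sym : forall A B, near A B -> near B A;
  prox_neq0 : forall A B, near A B -> A <> set0 /\ B <> set0;
  prox_meet : forall A B, A `&` B !=set0 -> near A B;
  prox_setU : forall A B C, near A (B `|` C) <-> near A B \/ near A C;
  prox_strong : forall A B, ~ near A B ->
    exists E, ~ near A E /\ ~ near (~` E) B
}.

Definition separated_near (T : Type) (near : set T -> set T -> Prop) : Prop :=
  forall x y : T, near [set x] [set y] <-> x = y.

Record proximity_space := ProximitySpace {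
  prox_carrier :> Type;
  prox_near : set prox_carrier -> set prox_carrier -> Prop;
  prox_axioms : is_proximity prox_near
}.

Arguments prox_near {p}.

Definition prox_closed (P : proximity_space) (A : set P) : Prop :=
  forall x, prox_near A [set x] -> A x.

Lemma prox_openT (P : proximity_space) : prox_closed (~` [set: P]).
Proof.
move=> x /(prox_neq0 (prox_axioms P)) [+ _].
by rewrite setCT.
Qed.

Lemma prox_openI (P : proximity_space) :
  setI_closed [set A : set P | prox_closed (~` A)].
Proof.
move=> A B /= cA cB x /(prox_sym (prox_axioms P)).
rewrite setCI => /(prox_setU (prox_axioms P)) [] nx.
- by left; apply: cA; exact: prox_sym (prox_axioms P) _ _ nx.
- by right; apply: cB; exact: prox_sym (prox_axioms P) _ _ nx.
Qed.

Lemma prox_open_bigU (P : proximity_space) (I : Type) (f : I -> set P) :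
  (forall i, prox_closed (~` f i)) -> prox_closed (~` \bigcup_i f i).
Proof.
move=> cf x /(prox_sym (prox_axioms P)) nx [i _ fix_].
apply: (cf i x) fix_; apply: (prox_sym (prox_axioms P)).
have -> : ~` f i = (~` \bigcup_j f j) `|` ~` f i.
  by apply/esym/setUidPr => y ny fy; apply: ny; exists i.
by apply/(prox_setU (prox_axioms P)); left.
Qed.

HB.instance Definition _ (P : proximity_space) :=
  gen_eqMixin (prox_carrier P).
HB.instance Definition _ (P : proximity_space) :=
  gen_choiceMixin (prox_carrier P).
HB.instance Definition _ (P : proximity_space) :=
  @isOpenTopological.Build (prox_carrier P)
    [set A : set P | prox_closed (~` A)]
    (@prox_openT P) (@prox_openI P) (@prox_open_bigU P).

Lemma prox_closedP (P : proximity_space) (A : set P) :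
  closed A <-> prox_closed A.
Proof. by rewrite -openC -{2}(setCK A); exact: iff_refl. Qed.

Definition compact_separated_proximity (T : Type)
    (near : set T -> set T -> Prop) : Prop :=
  exists P : is_proximity near,
    separated_near near /\ compact [set: ProximitySpace P].

Record csprox := CSProxSpace {
  cs_carrier :> Type;
  cs_near : set cs_carrier -> set cs_carrier -> Prop;
  cs_axioms : compact_separated_proximity cs_near
}.

Arguments cs_near {c}.

Record proximity_map (X Y : csprox) := ProximityMap {
  pmap_fun :> X -> Y;
  pmap_near : forall A B, cs_near A B ->
    cs_near (pmap_fun @` A) (pmap_fun @` B)
}.

Lemma pmap_eq (X Y : csprox) (f g : proximity_map X Y) :
  (forall x, f x = g x) -> f = g.
Proof.
case: f g => [f Hf] [g Hg] /= /funext fg.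
by subst g; congr ProximityMap; exact: Prop_irrelevance.
Qed.

Lemma pmap_id_subproof (X : csprox) (A B : set X) :
  cs_near A B -> cs_near (id @` A) (id @` B).
Proof. by rewrite !image_id. Qed.

Definition pmap_id (X : csprox) := ProximityMap (@pmap_id_subproof X).

Lemma pmap_comp_subproof (X Y Z : csprox) (g : proximity_map Y Z)
    (f : proximity_map X Y) (A B : set X) :
  cs_near A B -> cs_near ((g \o f) @` A) ((g \o f) @` B).
Proof. by move=> AB; rewrite -(image_comp f g A) -(image_comp f g B); exact: (pmap_near g (pmap_near f AB)). Qed.

Definition pmap_comp (X Y Z : csprox) (g : proximity_map Y Z)
  (f : proximity_map X Y) := ProximityMap (pmap_comp_subproof g f).

Definition CSProx : category.
Proof.
by refine (@Category csprox proximity_map pmap_id pmap_comp _ _ _) => *;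
  apply: pmap_eq.
Defined.

(* [bornology_set0] is the nullary case of closure under finite unions; it is
   automatic from the other axioms unless the set is empty. *)
Record is_bornology (T : Type) (bounded : set (set T)) : Prop := IsBornology {
  bornology_set1 : forall x, bounded [set x];
  bornology_sub : forall A B, A `<=` B -> bounded B -> bounded A;
  bornology_set0 : bounded set0;
  bornology_setU : forall A B, bounded A -> bounded B -> bounded (A `|` B)
}.

Record is_coarse_proximity (T : Type) (bounded : set (set T))
    (near : set T -> set T -> Prop) : Prop := IsCoarseProximity {
  cprox_sym : forall A B, near A B -> near B A;
  cprox_unbounded : forall A B, near A B -> ~ bounded A /\ ~ bounded B;
  cprox_meet : forall A B, ~ bounded (A `&` B) -> near A B;
  cprox_setU : forall A B C, near (A `|` B) C <-> near A C \/ near B C;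
  cprox_strong : forall A B, ~ near A B ->
    exists E, ~ near A E /\ ~ near (~` E) B
}.

Record coarse_proximity_space := CoarseProximitySpace {
  cp_carrier :> Type;
  bounded : set (set cp_carrier);
  cp_near : set cp_carrier -> set cp_carrier -> Prop;
  cp_bornology : is_bornology bounded;
  cp_axioms : is_coarse_proximity bounded cp_near
}.

Arguments bounded {c}.
Arguments cp_near {c}.

Definition resembles (X : coarse_proximity_space) (A B : set X) : Prop :=
  (forall B', B' `<=` B -> ~ bounded B' -> cp_near A B') /\
  (forall A', A' `<=` A -> ~ bounded A' -> cp_near A' B).

Record coarse_map (X Y : coarse_proximity_space) := CoarseMap {
  cmap_fun :> X -> Y;
  cmap_bounded : forall B, bounded B -> bounded (cmap_fun @` B);
  cmap_near : forall A B, cp_near A B ->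
    cp_near (cmap_fun @` A) (cmap_fun @` B)
}.

Definition close (X Y : coarse_proximity_space) (f g : X -> Y) : Prop :=
  forall A : set X, resembles (f @` A) (g @` A).

Lemma cmap_id_subproof1 (X : coarse_proximity_space) (B : set X) :
  bounded B -> bounded (id @` B).
Proof. by rewrite image_id. Qed.

Lemma cmap_id_subproof2 (X : coarse_proximity_space) (A B : set X) :
  cp_near A B -> cp_near (id @` A) (id @` B).
Proof. by rewrite !image_id. Qed.

Definition cmap_id (X : coarse_proximity_space) :=
  CoarseMap (@cmap_id_subproof1 X) (@cmap_id_subproof2 X).

Lemma cmap_comp_subproof1 (X Y Z : coarse_proximity_space)
    (g : coarse_map Y Z) (f : coarse_map X Y) (B : set X) :
  bounded B -> bounded ((g \o f) @` B).
Proof. by move=> bB; rewrite -(image_comp f g B); exact: (cmap_bounded g (cmap_bounded f bB)). Qed.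

Lemma cmap_comp_subproof2 (X Y Z : coarse_proximity_space)
    (g : coarse_map Y Z) (f : coarse_map X Y) (A B : set X) :
  cp_near A B -> cp_near ((g \o f) @` A) ((g \o f) @` B).
Proof. by move=> AB; rewrite -(image_comp f g A) -(image_comp f g B); exact: (cmap_near g (cmap_near f AB)). Qed.

Definition cmap_comp (X Y Z : coarse_proximity_space)
    (g : coarse_map Y Z) (f : coarse_map X Y) :=
  CoarseMap (cmap_comp_subproof1 g f) (cmap_comp_subproof2 g f).

Lemma cp_nearS (X : coarse_proximity_space) (A B C : set X) :
  A `<=` B -> cp_near A C -> cp_near B C.
Proof.
move=> /setUidPr <- AC.
by apply/(cprox_setU (cp_axioms X)); left.
Qed.

Lemma resembles_refl (X : coarse_proximity_space) (A : set X) :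
  resembles A A.
Proof.
split=> A' sA' uA'; apply: (cprox_meet (cp_axioms X)).
  by move/setIidPr: sA' => ->.
by move/setIidPl: sA' => ->.
Qed.

Lemma resembles_sym (X : coarse_proximity_space) (A B : set X) :
  resembles A B -> resembles B A.
Proof.
by move=> [AB BA]; split=> C sC uC; apply: (cprox_sym (cp_axioms X));
  [exact: BA | exact: AB].
Qed.

Lemma resembles_trans (X : coarse_proximity_space) (B A C : set X) :
  resembles A B -> resembles B C -> resembles A C.
Proof.
have half (D E F : set X) : resembles D E -> resembles E F ->
    forall D', D' `<=` D -> ~ bounded D' -> cp_near D' F.
  move=> [_ DE] [_ EF] D' sD uD; apply: contrapT.
  move=> /(cprox_strong (cp_axioms X)) [G [DG GF]]; apply: GF.
  have := cprox_sym (cp_axioms X) (DE _ sD uD).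
  rewrite -(setUIDK E G) => /(cprox_setU (cp_axioms X)) [] H.
    exfalso; apply: DG; apply: (cprox_sym (cp_axioms X)).
    by apply: cp_nearS H => x [].
  have [uG _] := cprox_unbounded (cp_axioms X) H.
  by apply: (@cp_nearS _ (E `\` G)) => [x []|] //; apply: EF => // x [].
move=> AB BC; split; last exact: half AB BC.
move=> C' sC uC; apply: (cprox_sym (cp_axioms X)).
exact: (half _ _ _ (resembles_sym BC) (resembles_sym AB)).
Qed.

Lemma resembles_image (X Y : coarse_proximity_space) (f : coarse_map X Y)
    (A B : set X) : resembles A B -> resembles (f @` A) (f @` B).
Proof.
have half (C D : set X) : (forall C', C' `<=` C -> ~ bounded C' ->
    cp_near C' D) -> forall C', C' `<=` f @` C -> ~ bounded C' ->
    cp_near C' (f @` D).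
  move=> CD C' sC uC.
  have imE : f @` (C `&` f @^-1` C') = C'.
    apply/seteqP; split=> [_ [x [_ ?] <-] //|y C'y].
    by have [x Cx fx] := sC _ C'y; exists x => //; split=> //=; rewrite fx.
  rewrite -imE; apply: cmap_near; apply: CD => [x [] //|bC].
  by apply: uC; rewrite -imE; apply: cmap_bounded.
move=> [AB BA]; split; last exact: half.
move=> C sC uC; apply: (cprox_sym (cp_axioms Y)); apply: (half B) => //.
by move=> D sD uD; apply: (cprox_sym (cp_axioms X)); exact: AB.
Qed.

Lemma close_refl (X Y : coarse_proximity_space) (f : X -> Y) : close f f.
Proof. by move=> A; exact: resembles_refl. Qed.

Lemma close_sym (X Y : coarse_proximity_space) (f g : X -> Y) :
  close f g -> close g f.
Proof. by move=> fg A; exact: resembles_sym. Qed.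

Lemma close_trans (X Y : coarse_proximity_space) (g f h : X -> Y) :
  close f g -> close g h -> close f h.
Proof. by move=> fg gh A; exact: resembles_trans (fg A) (gh A). Qed.

Lemma close_comp (X Y Z : coarse_proximity_space)
    (g g' : coarse_map Y Z) (f f' : coarse_map X Y) :
  close g g' -> close f f' -> close (g \o f) (g' \o f').
Proof.
move=> gg' ff' A; rewrite -(image_comp f g A) -(image_comp f' g' A).
exact: resembles_trans (gg' _) (resembles_image g' (ff' A)).
Qed.

Definition closeness_class (X Y : coarse_proximity_space)
    (f : coarse_map X Y) : set (coarse_map X Y) := [set g | close f g].

Record crsprox_hom (X Y : coarse_proximity_space) := CrsProxHom {
  crs_class :> set (coarse_map X Y);
  crs_classP : exists f, crs_class = closeness_class f
}.

Lemma crs_hom_eq (X Y : coarse_proximity_space) (c d : crsprox_hom X Y) :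
  crs_class c = crs_class d -> c = d.
Proof.
case: c d => [c Hc] [d Hd] /= cd.
by subst d; congr CrsProxHom; exact: Prop_irrelevance.
Qed.

Definition crs_mk (X Y : coarse_proximity_space) (f : coarse_map X Y) :
    crsprox_hom X Y :=
  CrsProxHom (ex_intro _ f erefl).

Lemma crs_mkP (X Y : coarse_proximity_space) (c : crsprox_hom X Y) :
  exists f, c = crs_mk f.
Proof. by have [f cf] := crs_classP c; exists f; exact: crs_hom_eq. Qed.

Lemma crs_mk_eq (X Y : coarse_proximity_space) (f g : coarse_map X Y) :
  crs_mk f = crs_mk g <-> close f g.
Proof.
split=> [[fg]|fg].
  have : closeness_class g g by exact: close_refl.
  by rewrite -fg.
apply: crs_hom_eq; apply/seteqP; split=> h /= H.
- exact: close_trans (close_sym fg) H.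
- exact: close_trans fg H.
Qed.

Definition crs_comp_class (X Y Z : coarse_proximity_space)
    (c : crsprox_hom Y Z) (d : crsprox_hom X Y) : set (coarse_map X Z) :=
  [set h | exists g f, [/\ crs_class c g, crs_class d f &
                           close (cmap_comp g f) h]].

Lemma crs_comp_classE (X Y Z : coarse_proximity_space)
    (g : coarse_map Y Z) (f : coarse_map X Y) :
  crs_comp_class (crs_mk g) (crs_mk f) = closeness_class (cmap_comp g f).
Proof.
apply/seteqP; split=> h /=.
  move=> [g' [f' [gg' ff' H]]].
  exact: close_trans (close_comp gg' ff') H.
by move=> H; exists g, f; split=> //; exact: close_refl.
Qed.

Lemma crs_comp_subproof (X Y Z : coarse_proximity_space)
    (c : crsprox_hom Y Z) (d : crsprox_hom X Y) :
  exists f, crs_comp_class c d = closeness_class f.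
Proof.
have [g ->] := crs_mkP c; have [f ->] := crs_mkP d.
by exists (cmap_comp g f); exact: crs_comp_classE.
Qed.

Definition crs_comp (X Y Z : coarse_proximity_space)
    (c : crsprox_hom Y Z) (d : crsprox_hom X Y) : crsprox_hom X Z :=
  CrsProxHom (crs_comp_subproof c d).

Lemma crs_compE (X Y Z : coarse_proximity_space)
    (g : coarse_map Y Z) (f : coarse_map X Y) :
  crs_comp (crs_mk g) (crs_mk f) = crs_mk (cmap_comp g f).
Proof. by apply: crs_hom_eq; exact: crs_comp_classE. Qed.

Definition CrsProx : category.
Proof.
refine (@Category coarse_proximity_space crsprox_hom
  (fun X => crs_mk (cmap_id X)) crs_comp _ _ _).
- move=> X Y c; have [f ->] := crs_mkP c; rewrite crs_compE.
  by apply/crs_mk_eq; exact: close_refl.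
- move=> X Y c; have [f ->] := crs_mkP c; rewrite crs_compE.
  by apply/crs_mk_eq; exact: close_refl.
- move=> X Y Z W c d e; have [h ->] := crs_mkP c; have [g ->] := crs_mkP d.
  have [f ->] := crs_mkP e; rewrite !crs_compE.
  by apply/crs_mk_eq; exact: close_refl.
Defined.

Record is_cluster (T : Type) (near : set T -> set T -> Prop)
    (sigma : set (set T)) : Prop := IsCluster {
  cluster_near : forall A B, sigma A -> sigma B -> near A B;
  cluster_max : forall A, (forall B, sigma B -> near A B) -> sigma A;
  cluster_setU : forall A B, sigma (A `|` B) -> sigma A \/ sigma B
}.

Definition smirnov (T : Type) (near : set T -> set T -> Prop) : Type :=
  {sigma : set (set T) | is_cluster near sigma}.

Definition smirnov_near (T : Type) (near : set T -> set T -> Prop)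
    (U V : set (smirnov near)) : Prop :=
  forall A C : set T,
    (forall sigma, U sigma -> sval sigma A) ->
    (forall sigma, V sigma -> sval sigma C) -> near A C.

Definition discrete_near (X : coarse_proximity_space) (A B : set X) : Prop :=
  A `&` B !=set0 \/ cp_near A B.

Definition boundary (X : coarse_proximity_space) : Type :=
  {sigma : smirnov (@discrete_near X) |
    forall A, sval sigma A -> ~ bounded A}.

Definition boundary_sets (X : coarse_proximity_space) (s : boundary X) :
  set (set X) := sval (sval s).

Definition boundary_near (X : coarse_proximity_space)
    (U V : set (boundary X)) : Prop :=
  smirnov_near (sval @` U) (sval @` V).

Definition boundary_image (X Y : coarse_proximity_space) (f : X -> Y)
    (s : boundary X) : set (set Y) :=
  [set A | forall C, boundary_sets s C -> discrete_near A (f @` C)].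

(* Main.v *)
Require Import Defs.
From mathcomp Require Import all_boot all_order.
From mathcomp Require Import boolp classical_sets functions topology.

Set Implicit Arguments.
Unset Strict Implicit.
Unset Printing Implicit Defensive.

Local Open Scope classical_set_scope.

(** Everything rests on one way of producing clusters.  Let [P] be a family of
    subsets of a proximity space which contains the whole space, is partition
    regular (if a union of two sets is in [P], one of the two is), and whose
    members are pairwise near.  Then the sets near every member of [P] form a
    cluster ([cluster_polar]).  Two instances are used.

    - For a proximity map [f] and a cluster [s], take the sets whose preimage
      under [f] is in [s]; the resulting cluster consists of the sets near
      [f @` C] for all [C] in [s], so this is the extension of [f] to the
      Smirnov compactifications ([polar_preimage]).
    - For an ultrafilter [F] of clusters, take the sets [C] such that [F]-almost
      every cluster contains [C]; the resulting cluster is a limit of [F].  This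
      is the compactness of the boundary ([boundary_compact]).

    In both cases the new cluster has no bounded member as soon as the old ones
    have none.  For the image under a coarse proximity map the reason is that
    such a map is automatically proper ([coarse_map_proper]): an unbounded set is
    near itself, so its image is near itself, hence unbounded.

    Functoriality and invariance under closeness are then inclusions between
    clusters, and an inclusion between clusters is an equality
    ([cluster_sub_eq]).  For closeness, if [A] is near every [f @` C] but far
    from some [g @` C], a set separating [A] from [g @` C] cuts [C] into two
    pieces; the piece that lies in the cluster is unbounded and has images under
    [f] and [g] that are not near, which closeness forbids
    ([boundary_image_close]). *)

(** * Proximities *)

Lemma prox_nearSr (T : Type) (near : set T -> set T -> Prop) (A B C : set T) :
  is_proximity near -> B `<=` C -> near A B -> near A C.
Proof.
by move=> pn /setUidPr <- AB; apply/(prox_setU pn); left.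
Qed.

Lemma prox_nearS (T : Type) (near : set T -> set T -> Prop)
    (A A' B B' : set T) : is_proximity near ->
  A `<=` A' -> B `<=` B' -> near A B -> near A' B'.
Proof.
move=> pn sA sB /(prox_nearSr pn sB)/(prox_sym pn)/(prox_nearSr pn sA).
exact: prox_sym pn _ _.
Qed.

Lemma proximity_preimage (S T : Type) (near : set T -> set T -> Prop)
    (i : S -> T) : is_proximity near ->
  is_proximity (fun A B : set S => near (i @` A) (i @` B)).
Proof.
move=> pn; split.
- by move=> A B; exact: prox_sym.
- by move=> A B /(prox_neq0 pn) [A0 B0]; split=> E0;
    [apply: A0 | apply: B0]; rewrite E0 image_set0.
- by move=> A B [x [Ax Bx]]; apply: (prox_meet pn); exists (i x); split; exists x.
- by move=> A B C; rewrite image_setU; exact: prox_setU.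
- move=> A B /(prox_strong pn) [E [AE EB]]; exists (i @^-1` E); split=> H.
  + by apply: AE; apply: prox_nearSr H => //; exact: image_preimage_subset.
  + apply: EB; apply: (prox_nearS pn _ _ H) => //.
    by move=> _ [x nEx <-].
Qed.

(** The separating set given by the coarse axiom need not be disjoint from [A]
    nor have a complement disjoint from [B]; moving [A] out of it and [B] into
    it repairs both and changes nothing coarsely, [A] and [B] being far. *)
Lemma discrete_near_proximity (X : coarse_proximity_space) :
  is_proximity (@discrete_near X).
Proof.
have cX := cp_axioms X; have bX := cp_bornology X.
split.
- move=> A B [AB|AB]; first by left; rewrite setIC.
  by right; exact: cprox_sym cX _ _ AB.
- move=> A B [[x [Ax Bx]]|/(cprox_unbounded cX) [uA uB]]; split=> E0.
  + by rewrite E0 in Ax.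
  + by rewrite E0 in Bx.
  + by apply: uA; rewrite E0; exact: bornology_set0.
  + by apply: uB; rewrite E0; exact: bornology_set0.
- by move=> A B ?; left.
- move=> A B C; split.
    move=> [[x [Ax [Bx|Cx]]]|]; first by left; left; exists x.
      by right; left; exists x.
    move/(cprox_sym cX)/(cprox_setU cX) => [|] H.
      by left; right; exact: cprox_sym cX _ _ H.
    by right; right; exact: cprox_sym cX _ _ H.
  move=> [[[x [Ax Bx]]|H]|[[x [Ax Cx]]|H]].
  + by left; exists x; split=> //; left.
  + right; apply: (cprox_sym cX); apply/(cprox_setU cX); left.
    exact: cprox_sym cX _ _ H.
  + by left; exists x; split=> //; right.
  + right; apply: (cprox_sym cX); apply/(cprox_setU cX); right.
    exact: cprox_sym cX _ _ H.
- move=> A B /not_orP [AB0 AB].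
  have [E [AE EB]] := cprox_strong cX AB.
  exists ((E `\` A) `|` B); split=> -[].
  + by move=> [x [Ax [[_ //]|Bx]]]; apply: AB0; exists x.
  + move/(cprox_sym cX)/(cprox_setU cX) => [|] /(cprox_sym cX) H //.
    apply: AE; apply: (cprox_sym cX); move/(cprox_sym cX): H.
    by apply: cp_nearS => x [].
  + by move=> [x [nx Bx]]; apply: nx; right.
  + move=> H; have /(cprox_setU cX) [//|//] : cp_near (~` E `|` A) B.
    apply: cp_nearS H => x nx; case: (pselect (A x)) => Ax; first by right.
    by left=> Ex; apply: nx; left.
Qed.

(** * Clusters *)

Definition partition_regular (T : Type) (P : set (set T)) : Prop :=
  P setT /\ forall A B, P (A `|` B) -> P A \/ P B.

Definition polar (T : Type) (near : set T -> set T -> Prop)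
  (P : set (set T)) : set (set T) := [set A | forall C, P C -> near A C].

Lemma partition_regularC (T : Type) (P : set (set T)) (A : set T) :
  partition_regular P -> ~ P A -> P (~` A).
Proof. by move=> [PT PU] nA; have [] := PU A (~` A); rewrite ?setUv. Qed.

Lemma partition_regularI (T : Type) (P : set (set T)) (A B : set T) :
  partition_regular P -> ~ P (~` A) -> ~ P (~` B) -> P (A `&` B).
Proof.
move=> [PT PU] nA nB; apply: contrapT => nAB.
have := PT; rewrite -(setUv (A `&` B)) setCI.
by move=> /PU [//|/PU []].
Qed.

(** Maximality is immediate since [P] lies in its own polar.  For the other two
    properties, take separating sets: [P] meets every finite partition of the
    space, and the only admissible block contradicts farness. *)
Lemma cluster_polar (T : Type) (near : set T -> set T -> Prop)
    (P : set (set T)) : is_proximity near -> partition_regular P ->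
  (forall A B, P A -> P B -> near A B) -> is_cluster near (polar near P).
Proof.
move=> pn rP nP; split.
- move=> A B PA PB; apply: contrapT => /(prox_strong pn) [E [AE EB]].
  have nE : ~ P E by move=> /PA.
  by apply: EB; apply: (prox_sym pn); apply: PB; exact: partition_regularC.
- by move=> A HA C PC; apply: HA => D PD; exact: nP.
- move=> A B PAB; apply: contrapT => /not_orP [nA nB].
  have [C PC AC] : exists2 C, P C & ~ near A C.
    apply: contrapT => H; apply: nA => C PC; apply: contrapT => AC.
    by apply: H; exists C.
  have [D PD BD] : exists2 D, P D & ~ near B D.
    apply: contrapT => H; apply: nB => D PD; apply: contrapT => BD.
    by apply: H; exists D.
  have [E [AE EC]] := prox_strong pn AC.
  have [F [BF FD]] := prox_strong pn BD.
  have PEF : P (E `&` F).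
    by apply: partition_regularI => // H; [apply: EC | apply: FD]; exact: nP.
  have /(prox_sym pn)/(prox_setU pn) [] := PAB _ PEF => /(prox_sym pn) H.
  + by apply: AE; apply: prox_nearSr H => // x [].
  + by apply: BF; apply: prox_nearSr H => // x [].
Qed.

Lemma cluster_regular (T : Type) (near : set T -> set T -> Prop)
    (s : set (set T)) : is_proximity near -> is_cluster near s ->
  partition_regular s.
Proof.
move=> pn cs; split; last exact: cluster_setU cs.
apply: (cluster_max cs) => B sB; apply: (prox_meet pn).
have /(prox_neq0 pn) [B0 _] := cluster_near cs sB sB.
by rewrite setTI; apply/set0P/eqP.
Qed.

Lemma cluster_polarE (T : Type) (near : set T -> set T -> Prop)
    (s : set (set T)) : is_cluster near s -> polar near s = s.
Proof.
move=> cs; apply/seteqP; split=> A; first exact: cluster_max cs _.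
by move=> sA B; exact: cluster_near cs _ _ sA.
Qed.

Lemma cluster_nearS (T : Type) (near : set T -> set T -> Prop)
    (s : set (set T)) (A B : set T) : is_proximity near -> is_cluster near s ->
  A `<=` B -> s A -> s B.
Proof.
move=> pn cs AB sA; apply: (cluster_max cs) => C sC.
by apply: (prox_nearS pn AB (@subset_refl _ C)); exact: cluster_near cs _ _ sA sC.
Qed.

Lemma cluster_sub_eq (T : Type) (near : set T -> set T -> Prop)
    (s t : set (set T)) : is_cluster near s -> is_cluster near t ->
  s `<=` t -> s = t.
Proof.
move=> cs ct st; apply/seteqP; split=> // A tA.
by apply: (cluster_max cs) => B /st tB; exact: cluster_near ct _ _ tA tB.
Qed.

(** * The Smirnov proximity *)

(** Clusters are not closed under intersection.  So, for additivity, the two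
    sets that belong to all clusters of [U] and witness that [U] is far from [V]
    and from [W] are first enlarged to proximal neighbourhoods; these can be
    intersected, by [partition_regularI]. *)
Lemma smirnov_proximity (T : Type) (near : set T -> set T -> Prop) :
  is_proximity near -> is_proximity (@smirnov_near T near).
Proof.
move=> pn.
have farP (U V : set (smirnov near)) : ~ smirnov_near U V -> exists A C,
    [/\ forall s, U s -> sval s A, forall s, V s -> sval s C & ~ near A C].
  move=> H; apply: contrapT => H'; apply: H => A C UA VC.
  by apply: contrapT => AC; apply: H'; exists A, C.
have symS (U V : set (smirnov near)) : smirnov_near U V -> smirnov_near V U.
  by move=> UV A C VA UC; apply: (prox_sym pn); exact: UV.
have monoS (U V W : set (smirnov near)) :
    V `<=` W -> smirnov_near U V -> smirnov_near U W.
  by move=> VW UV A C UA WC; apply: UV => // s /VW; exact: WC.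
have neq0 (U V : set (smirnov near)) : smirnov_near U V -> U <> set0.
  move=> UV U0; have /(prox_neq0 pn) [//] : near set0 setT.
  apply: UV => [s|s _]; first by rewrite U0.
  by have [] := cluster_regular pn (proj2_sig s).
split=> //.
- by move=> U V UV; split; [exact: neq0 UV | exact: neq0 (symS _ _ UV)].
- by move=> U V [s [Us Vs]] A C /(_ s Us) sA /(_ s Vs) sC;
    exact: (cluster_near (proj2_sig s)).
- move=> U V W; split; last by move=> [] UV;
    apply: monoS UV; [exact: subsetUl | exact: subsetUr].
  move=> UVW; apply: contrapT => /not_orP.
  move=> [/farP [A [C [UA VC AC]]] /farP [B [D [UB WD BD]]]].
  have [E [CE EA]] := prox_strong pn (fun H => AC (prox_sym pn H)).
  have [F [DF FB]] := prox_strong pn (fun H => BD (prox_sym pn H)).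
  have : near (E `&` F) (C `|` D).
    apply: UVW => s.
      move=> Us; have cs := proj2_sig s.
      apply: partition_regularI; first exact: cluster_regular cs.
      - by move=> sE; apply: EA; apply: (cluster_near cs) => //; exact: UA.
      - by move=> sF; apply: FB; apply: (cluster_near cs) => //; exact: UB.
    have cs := proj2_sig s.
    by move=> [/VC|/WD]; apply: (cluster_nearS pn cs);
      [exact: subsetUl | exact: subsetUr].
  move=> /(prox_setU pn) [] /(prox_sym pn) H.
  + by apply: CE; apply: prox_nearSr H => // x [].
  + by apply: DF; apply: prox_nearSr H => // x [].
- move=> U V /farP [A [C [UA VC /(prox_strong pn) [E [AE EC]]]]].
  exists [set s | sval s E]; split=> [H|H]; first by apply: AE; exact: H.
  apply: EC; apply: H => // s /=.
  by apply: partition_regularC; exact: cluster_regular (proj2_sig s).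
Qed.

(** * Images of clusters under proximity maps *)

Definition near_preserving (S T : Type) (nearS : set S -> set S -> Prop)
    (nearT : set T -> set T -> Prop) (f : S -> T) : Prop :=
  forall A B, nearS A B -> nearT (f @` A) (f @` B).

(** A set [C] of [s] is contained in [f @^-1` (f @` C)], and
    [f @` (f @^-1` B)] is contained in [B]; preimages, unlike images, make the
    partition regularity of the defining family evident even when [f] is not
    surjective. *)
Lemma polar_preimage (S T : Type) (nearS : set S -> set S -> Prop)
    (nearT : set T -> set T -> Prop) (f : S -> T) (s : set (set S)) :
  is_proximity nearS -> is_proximity nearT -> is_cluster nearS s ->
  polar nearT [set B | s (f @^-1` B)] =
  [set A | forall C, s C -> nearT A (f @` C)].
Proof.
move=> pS pT cs; apply/seteqP; split=> A HA C sC.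
  by apply: HA; apply: (cluster_nearS pS cs _ sC); exact: preimage_image.
by apply: prox_nearSr (HA _ sC) => //; exact: image_preimage_subset.
Qed.

Lemma preimage_regular (S T : Type) (nearS : set S -> set S -> Prop)
    (nearT : set T -> set T -> Prop) (f : S -> T) (s : set (set S)) :
  is_proximity nearS -> is_proximity nearT -> near_preserving nearS nearT f ->
  is_cluster nearS s ->
  partition_regular [set B | s (f @^-1` B)] /\
  forall A B, s (f @^-1` A) -> s (f @^-1` B) -> nearT A B.
Proof.
move=> pS pT nf cs; split.
  have [sT sU] := cluster_regular pS cs; split=> [|A B] /=.
    by rewrite preimage_setT.
  by rewrite preimage_setU => /sU.
move=> A B sA sB; have := nf _ _ (cluster_near cs sA sB).
by apply: prox_nearS => //; exact: image_preimage_subset.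
Qed.

Lemma cluster_image (S T : Type) (nearS : set S -> set S -> Prop)
    (nearT : set T -> set T -> Prop) (f : S -> T) (s : set (set S)) :
  is_proximity nearS -> is_proximity nearT -> near_preserving nearS nearT f ->
  is_cluster nearS s ->
  is_cluster nearT [set A | forall C, s C -> nearT A (f @` C)].
Proof.
move=> pS pT nf cs; rewrite -(polar_preimage f pS pT cs).
by have [rP nP] := preimage_regular pS pT nf cs; exact: cluster_polar.
Qed.

(** A set far from a member of the image cluster is not in that cluster, so its
    preimage is not in [s], and the complement of the preimage is. *)
Lemma cluster_image_far (S T : Type) (nearS : set S -> set S -> Prop)
    (nearT : set T -> set T -> Prop) (f : S -> T) (s : set (set S))
    (A B : set T) :
  is_proximity nearS -> is_proximity nearT -> is_cluster nearS s ->
  (forall C, s C -> nearT A (f @` C)) -> ~ nearT A B -> s (f @^-1` (~` B)).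
Proof.
move=> pS pT cs sA AB; rewrite preimage_setC.
apply: partition_regularC; first exact: cluster_regular cs.
move=> /sA H; apply: AB; apply: prox_nearSr H => //.
exact: image_preimage_subset.
Qed.

(** * The boundary as a compact separated proximity space *)

Lemma boundary_cluster (X : coarse_proximity_space) (s : boundary X) :
  is_cluster (@discrete_near X) (boundary_sets s).
Proof. exact: proj2_sig (sval s). Qed.

Lemma boundary_eq (X : coarse_proximity_space) (s t : boundary X) :
  boundary_sets s = boundary_sets t -> s = t.
Proof.
have sval_inj (T : Type) (P : T -> Prop) : injective (@sval T P).
  by case=> [a Pa] [b Pb] /=; exact: eq_exist.
by move=> st; exact: sval_inj _ _ _ _ (sval_inj _ _ _ _ st).
Qed.

Lemma boundary_sub_eq (X : coarse_proximity_space) (s t : boundary X) :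
  boundary_sets s `<=` boundary_sets t -> s = t.
Proof.
move=> st; apply: boundary_eq.
exact: cluster_sub_eq (boundary_cluster s) (boundary_cluster t) st.
Qed.

Lemma boundary_nearP (X : coarse_proximity_space) (U V : set (boundary X)) :
  boundary_near U V <-> forall A C,
    (forall s, U s -> boundary_sets s A) ->
    (forall s, V s -> boundary_sets s C) -> discrete_near A C.
Proof.
split=> UV A C UA VC; apply: UV.
- by move=> _ [s Us <-]; exact: UA.
- by move=> _ [s Us <-]; exact: VC.
- by move=> s Us; apply: UA; exists s.
- by move=> s Us; apply: VC; exists s.
Qed.

Lemma boundary_proximity (X : coarse_proximity_space) :
  is_proximity (@boundary_near X).
Proof.
apply: proximity_preimage; apply: smirnov_proximity.
exact: discrete_near_proximity.
Qed.

Lemma boundary_separated (X : coarse_proximity_space) :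
  separated_near (@boundary_near X).
Proof.
move=> s t; split=> [/boundary_nearP st|->].
  apply: boundary_sub_eq => A sA; apply: (cluster_max (boundary_cluster t)).
  by move=> B tB; apply: st => _ ->.
by apply: (prox_meet (boundary_proximity X)); exists t.
Qed.

Lemma discrete_near_boundedC (X : coarse_proximity_space) (A : set X) :
  bounded A -> ~ discrete_near A (~` A).
Proof.
move=> bA [[x [Ax nAx]] //|].
by move/(cprox_unbounded (cp_axioms X)) => [].
Qed.

(** The limit of an ultrafilter [F] is the polar of the sets belonging to
    [F]-almost every cluster: if a closed set [Z] does not contain this limit
    [p], some [A] common to all clusters of [Z] is far from a member of [p], so
    [A] is not in [F]-almost every cluster and [Z] is not in [F]. *)
Lemma boundary_compact (X : coarse_proximity_space) :
  compact [set: ProximitySpace (boundary_proximity X)].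
Proof.
rewrite compact_ultra => F FU _.
have pX := discrete_near_proximity X.
pose P : set (set X) := [set C | F [set s : boundary X | boundary_sets s C]].
have rP : partition_regular P.
  split.
    rewrite /P /=; apply: (filterS _ filterT) => s _ /=.
    by have [] := cluster_regular pX (boundary_cluster s).
  move=> A B PAB.
  have [FA|FA] := in_ultra_setVsetC [set s : boundary X | boundary_sets s A] FU.
    by left.
  right; apply: filterS2 FA PAB => s nA sAB.
  by have [//|] := cluster_setU (boundary_cluster s) sAB.
have nP A B : P A -> P B -> discrete_near A B.
  rewrite /P /= => PA PB; have [s [sA sB]] := filter_ex (filterI PA PB).
  exact: cluster_near (boundary_cluster s) _ _ sA sB.
have cP := cluster_polar pX rP nP.
have uP A : polar (@discrete_near X) P A -> ~ bounded A.
  move=> QA bA; have nPA : ~ P (~` A).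
    by move=> /QA; exact: discrete_near_boundedC.
  have := partition_regularC rP nPA; rewrite setCK /P /= => /filter_ex [s sA].
  exact: (proj2_sig s) sA bA.
pose p : boundary X := exist _ (exist _ _ cP) uP.
exists p; split=> // V; rewrite nbhsE => -[W [oW Wp] WV].
apply: filterS WV _; apply: contrapT => nFW.
have FW : F (~` W) by have [] := in_ultra_setVsetC W FU.
have /prox_closedP cW : closed (~` W) by exact: open_closedC.
apply: (cW p) => //; apply/boundary_nearP => A C WA pC.
have PA : P A by apply: filterS FW => s /WA.
by apply: (prox_sym pX); exact: (pC p erefl).
Qed.

Lemma boundary_compact_separated (X : coarse_proximity_space) :
  compact_separated_proximity (@boundary_near X).
Proof.
exists (boundary_proximity X); split; first exact: boundary_separated.
exact: boundary_compact.
Qed.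

(** * The induced map between boundaries *)

Lemma coarse_map_discrete (X Y : coarse_proximity_space) (f : coarse_map X Y) :
  near_preserving (@discrete_near X) (@discrete_near Y) f.
Proof.
move=> A B [[x [Ax Bx]]|AB]; last by right; exact: cmap_near.
by left; exists (f x); split; exists x.
Qed.

Lemma coarse_map_proper (X Y : coarse_proximity_space) (f : coarse_map X Y)
    (A : set X) : bounded (f @` A) -> bounded A.
Proof.
move=> bfA; apply: contrapT => uA.
have AA : cp_near A A by apply: (cprox_meet (cp_axioms X)); rewrite setIid.
by have [] := cprox_unbounded (cp_axioms Y) (cmap_near f AA).
Qed.

Lemma boundary_image_cluster (X Y : coarse_proximity_space)
    (f : coarse_map X Y) (s : boundary X) :
  is_cluster (@discrete_near Y) (boundary_image f s).
Proof.
apply: cluster_image (boundary_cluster s); first exact: discrete_near_proximity.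
- exact: discrete_near_proximity.
- exact: coarse_map_discrete.
Qed.

Lemma boundary_image_unbounded (X Y : coarse_proximity_space)
    (f : coarse_map X Y) (s : boundary X) (A : set Y) :
  boundary_image f s A -> ~ bounded A.
Proof.
move=> sA bA.
have sfA : boundary_sets s (f @^-1` (~` ~` A)).
  apply: (cluster_image_far _ _ (boundary_cluster s) sA).
  - exact: discrete_near_proximity.
  - exact: discrete_near_proximity.
  - exact: discrete_near_boundedC.
rewrite setCK in sfA.
apply: (proj2_sig s _ sfA); apply: (coarse_map_proper (f := f)).
apply: (bornology_sub (cp_bornology Y)) bA; exact: image_preimage_subset.
Qed.

Definition boundary_map (X Y : coarse_proximity_space) (f : coarse_map X Y)
    (s : boundary X) : boundary Y :=
  exist _ (exist _ (boundary_image f s) (boundary_image_cluster f s))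
    (@boundary_image_unbounded X Y f s).

(** If the images of [U] and [V] were separated by far sets [A] and [C], two
    applications of the strong axiom would give far proximal neighbourhoods
    [~` G] of [A] and [E] of [C]; their preimages belong to all clusters of [U]
    and of [V] respectively, hence are near, a contradiction. *)
Lemma boundary_map_near (X Y : coarse_proximity_space) (f : coarse_map X Y)
    (U V : set (boundary X)) : boundary_near U V ->
  boundary_near (boundary_map f @` U) (boundary_map f @` V).
Proof.
have pX := discrete_near_proximity X; have pY := discrete_near_proximity Y.
move=> /boundary_nearP UV; apply/boundary_nearP => A C UA VC.
apply: contrapT => /(prox_strong pY) [E [AE EC]].
have [G [AG GE]] := prox_strong pY AE.
apply: GE; have : discrete_near (f @^-1` (~` G)) (f @^-1` (~` ~` E)).
  apply: UV => s Us.
    apply: (cluster_image_far pX pY (boundary_cluster s) _ AG).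
    exact: (UA (boundary_map f s)) (imageP _ Us).
  apply: (cluster_image_far pX pY (boundary_cluster s) _
    (fun H => EC (prox_sym pY H))).
  exact: (VC (boundary_map f s)) (imageP _ Us).
rewrite setCK => /(coarse_map_discrete f).
by apply: prox_nearS => //; exact: image_preimage_subset.
Qed.

Lemma boundary_map_id (X : coarse_proximity_space) (s : boundary X) :
  boundary_map (cmap_id X) s = s.
Proof.
apply: boundary_sub_eq => A sA; apply: (cluster_max (boundary_cluster s)).
by move=> B /sA; rewrite image_id.
Qed.

Lemma boundary_map_comp (X Y Z : coarse_proximity_space)
    (g : coarse_map Y Z) (f : coarse_map X Y) (s : boundary X) :
  boundary_map (cmap_comp g f) s = boundary_map g (boundary_map f s).
Proof.
apply/esym/boundary_sub_eq => A sA C sC /=.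
rewrite -(image_comp f g C); apply: sA => D sD.
by apply: (coarse_map_discrete f); exact: cluster_near (boundary_cluster s) _ _ sC sD.
Qed.

(** Suppose [A] is in the image cluster under [f], [C] is in [s] and [A] is far
    from [g @` C]; choose [E] far from [A] with [~` E] far from [g @` C].  The
    part [D] of [C] sent by [f] outside [E] is in [s], hence unbounded, so
    closeness makes [f @` D] near [g @` D], although they lie in the far sets
    [~` E] and [g @` C]. *)
Lemma boundary_image_close (X Y : coarse_proximity_space)
    (f g : coarse_map X Y) (s : boundary X) :
  Defs.close f g -> boundary_image f s `<=` boundary_image g s.
Proof.
have pY := discrete_near_proximity Y.
move=> fg A sA C sC; apply: contrapT => /(prox_strong pY) [E [AE EC]].
have : boundary_sets s ((C `&` f @^-1` E) `|` (C `\` f @^-1` E)).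
  by rewrite setUIDK.
move=> /(cluster_setU (boundary_cluster s)) [sD|].
  apply: AE; apply: prox_nearSr (sA _ sD) => //.
  by move=> _ [x [_ Ex] <-].
set D := C `\` _ => sD; apply: EC.
have uD : ~ bounded (f @` D).
  by move=> /coarse_map_proper; exact: (proj2_sig s _ sD).
have [_ /(_ (f @` D) (@subset_refl _ _) uD) fgD] := fg D.
apply: (prox_nearS pY _ _ (or_intror fgD)) => _ [x [Cx nEx] <-] //.
Qed.

Lemma boundary_map_close (X Y : coarse_proximity_space)
    (f g : coarse_map X Y) (s : boundary X) :
  Defs.close f g -> boundary_map f s = boundary_map g s.
Proof. by move=> fg; apply: boundary_sub_eq; exact: boundary_image_close. Qed.

(** * The boundary functor *)

Definition boundary_space (X : coarse_proximity_space) : csprox :=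
  CSProxSpace (boundary_compact_separated X).

Definition boundary_pmap (X Y : coarse_proximity_space) (f : coarse_map X Y) :
    proximity_map (boundary_space X) (boundary_space Y) :=
  @ProximityMap (boundary_space X) (boundary_space Y) _ (@boundary_map_near X Y f).

Definition boundary_hom (X Y : coarse_proximity_space) (c : crsprox_hom X Y) :
    proximity_map (boundary_space X) (boundary_space Y) :=
  boundary_pmap (sval (cid (crs_mkP c))).

Lemma boundary_homE (X Y : coarse_proximity_space) (f : coarse_map X Y) :
  boundary_hom (crs_mk f) = boundary_pmap f.
Proof.
rewrite /boundary_hom; case: cid => g /= /crs_mk_eq fg.
by apply: pmap_eq => s; apply/esym; exact: boundary_map_close.
Qed.

Theorem theorem4p14 :
  exists (HU : forall X : coarse_proximity_space,
            compact_separated_proximity (@boundary_near X))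
         (U1 : forall X Y : CrsProx,
            @hom CrsProx X Y ->
            @hom CSProx (CSProxSpace (HU X)) (CSProxSpace (HU Y))),
    @is_functor CrsProx CSProx (fun X => CSProxSpace (HU X)) U1 /\
    forall (X Y : coarse_proximity_space) (f : coarse_map X Y)
           (s : boundary X),
      boundary_sets (U1 X Y (crs_mk f) s) = boundary_image f s.
Proof.
exists boundary_compact_separated, boundary_hom; split; last first.
  by move=> X Y f s; rewrite boundary_homE.
split=> [X|X Y Z c d].
  change (boundary_hom (crs_mk (cmap_id X)) = pmap_id (boundary_space X)).
  by rewrite boundary_homE; apply: pmap_eq => s; exact: boundary_map_id.
change (boundary_hom (crs_comp c d) = pmap_comp (boundary_hom c) (boundary_hom d)).
have [g ->] := crs_mkP c; have [f ->] := crs_mkP d.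
rewrite crs_compE !boundary_homE; apply: pmap_eq => s.
exact: boundary_map_comp.
Qed.
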